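(* Let $p\in\mathbb{R}$, $p\neq 0$. Then a real normed linear space $X=(X,\|\cdot\|)$ with $\dim X\geq 3$ is an inner product space if and only if the inequality $$\alpha_p[x,y]\geq \frac{2\|x\|^{p}\|y\|^{p}\alpha[x,y]+\left(\|x\|^{p}-\|y\|^{p}\right)^{2}}{\|x\|^{p}+\|y\|^{p}}$$ holds for all nonzero vectors $x,y\in X$.
   Context: For $p\in\mathbb{R}$ and nonzero vectors $x,y\in X$, the $p$-angular distance is $\alpha_p[x,y]=\big\|\,\|x\|^{p-1}x-\|y\|^{p-1}y\,\big\|$, and $\alpha[x,y]=\alpha_0[x,y]=\left\|\frac{x}{\|x\|}-\frac{y}{\|y\|}\right\|$ is the angular distance. A normed linear space is called an inner product space if its norm is induced by an inner product. *)

(* Defs.v *)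
From mathcomp Require Import all_boot all_order all_algebra.
From mathcomp Require Import reals normedtype exp.

Set Implicit Arguments.
Unset Strict Implicit.
Unset Printing Implicit Defensive.

Import Order.TTheory GRing.Theory Num.Theory.
Import numFieldNormedType.Exports.
Local Open Scope ring_scope.

(* [a `^ p] is only ever meant to be used here with a > 0 (nonzero vectors). *)
Definition p_angular_distance (R : realType) (X : normedModType R) (p : R)
    (x y : X) : R :=
  `| (`|x| `^ (p - 1)) *: x - (`|y| `^ (p - 1)) *: y |.

Definition angular_distance (R : realType) (X : normedModType R) (x y : X) : R :=
  `| `|x|^-1 *: x - `|y|^-1 *: y |.

Lemma p_angular_distance0 (R : realType) (X : normedModType R) (x y : X) :
  x != 0 -> y != 0 -> p_angular_distance 0 x y = angular_distance x y.
Proof.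
by move=> x0 y0; rewrite /p_angular_distance sub0r !powRN !powRr1.
Qed.

(* Makes sense for a possibly infinite-dimensional V. *)
Definition dim_at_least (R : realType) (V : lmodType R) (n : nat) : Prop :=
  exists v : 'I_n -> V,
    forall c : 'I_n -> R, \sum_(i < n) c i *: v i = 0 -> forall i, c i = 0.

(* [{dot X for idfun}] is the type of symmetric positive definite bilinear
   forms on the real space X. *)
Definition inner_product_space (R : realType) (X : normedModType R) : Prop :=
  exists f : {dot X for (@idfun R)}, forall x : X, `|x| = Num.sqrt (f x x).

(* Main.v *)
Require Import Defs.
From HB Require Import structures.
From mathcomp Require Import all_boot all_order all_algebra.
From mathcomp Require Import classical_sets reals topology normedtype exp.
From mathcomp Require Import ring lra.

Set Implicit Arguments.
Unset Strict Implicit.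
Unset Printing Implicit Defensive.

Import Order.TTheory GRing.Theory Num.Theory.
Import numFieldNormedType.Exports.
Local Open Scope ring_scope.

(** Write N for the norm.  With a = N(x)^p and b = N(y)^p, which range over all
    positive reals because p <> 0, and with u, v the normalizations of x, y, the
    inequality becomes, whatever p is,

      2ab N(u - v) + (a - b)^2 <= (a + b) N(au - bv)

    for unit vectors u, v and a, b > 0 ([p_angular_rescale]).

    In an inner product space, put c = N(u - v).  Then
    N(au - bv)^2 = (a - b)^2 + ab c^2, and the difference of the squares of the
    two sides is ab (a - b)^2 (2 - c)^2 >= 0 ([inner_product_angular]).

    Conversely, replace v by - v and take a = 1 + t, b = 1 - t.  As
    N(u + v) <= 2, the inequality gives N(u + v) <= N(u + v + t(u - v)) for
    abs(t) < 1, and convexity extends this to every t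
    ([angular_isosceles_birkhoff]).  So, whenever N(u) = N(v), the sum u + v is
    Birkhoff orthogonal to the difference u - v: the midpoint of a chord of a
    sphere minimizes the norm on the line of that chord.  It remains to see that
    this property [isosceles_birkhoff] forces an inner product.

    - If the norm has a strict minimum at y on the line y + td, then all chords
      of that line have y as their midpoint, so the norm is symmetric about y on
      the line ([strict_min_symmetric]).
    - Strict convexity ([isosceles_birkhoff_strict_convex]) makes all minima
      strict.  If [p, q] were a flat segment of a sphere and d = q - p, then d
      would be the strict minimum on each line through d directed by an interior
      point of the segment, and the resulting symmetries would make the norm
      periodic on the line through p and q.
    - Hence N(u + v + t(u - v)) is even in t when N(u) = N(v), which is Ficken's
      condition N(ax + by) = N(bx + ay) for N(x) = N(y) ([ficken]).
    - Given unit vectors e, f with N(e + tf) even in t, let w = ae + bf have norm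
      n.  The symmetry exchanging ne and w sends bf, which is w - ae, to a
      vector whose coordinates are known; comparing with the evident symmetries
      of the frame gives n^2 = a^2 + b^2 ([pythagoras_unit]).
    - Every plane has such a frame ([symmetric_foot]), so N^2 is a quadratic form
      on each plane.  This yields the parallelogram law and, by polarization as
      in the Jordan-von Neumann theorem, the inner product. *)

(** * Linear combinations of two vectors *)

(** Instance resolution computes the coordinates of a vector expression in e and
    f, so that the tactic [lincomb] reduces an identity between such expressions
    to two identities between scalars. *)
Class combination (R : pzRingType) (V : lmodType R) (e f v : V) (a b : R) :=
  combinationE : v = a *: e + b *: f.

#[local] Instance combination_l (R : pzRingType) (V : lmodType R) (e f : V) :
  combination e f e 1 0.
Proof. by rewrite /combination scale1r scale0r addr0. Qed.

#[local] Instance combination_r (R : pzRingType) (V : lmodType R) (e f : V) :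
  combination e f f 0 1.
Proof. by rewrite /combination scale1r scale0r add0r. Qed.

#[local] Instance combinationD (R : pzRingType) (V : lmodType R) (e f v w : V)
  (a b c d : R) : combination e f v a b -> combination e f w c d ->
  combination e f (v + w) (a + c) (b + d).
Proof. by move=> -> ->; rewrite /combination !scalerDl addrACA. Qed.

#[local] Instance combinationN (R : pzRingType) (V : lmodType R) (e f v : V)
  (a b : R) : combination e f v a b -> combination e f (- v) (- a) (- b).
Proof. by move=> ->; rewrite /combination !scaleNr opprD. Qed.

#[local] Instance combinationZ (R : pzRingType) (V : lmodType R) (e f v : V)
  (k a b : R) : combination e f v a b ->
  combination e f (k *: v) (k * a) (k * b).
Proof. by move=> ->; rewrite /combination scalerDr !scalerA. Qed.

Lemma combination_eq (R : pzRingType) (V : lmodType R) (e f v w : V)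
    (a b c d : R) : combination e f v a b -> combination e f w c d ->
  a = c -> b = d -> v = w.
Proof. by move=> -> -> -> ->. Qed.

Ltac lincomb e f :=
  refine (@combination_eq _ _ e f _ _ _ _ _ _ _ _ _ _).

(** * From midpoints of chords to Ficken's symmetry *)

(** With s = u + v and d = u - v, the hypothesis says that s and d are isosceles
    orthogonal, that is s + d and s - d have the same norm, and the conclusion
    says that s is Birkhoff orthogonal to d. *)
Definition isosceles_birkhoff (R : realType) (X : normedModType R) : Prop :=
  forall (u v : X) (t : R), `|u| = `|v| -> `|u + v| <= `|u + v + t *: (u - v)|.

Lemma norm_line_attains (R : realType) (X : normedModType R) (y d : X) (M : R) :
  d != 0 -> `|y| <= M -> exists2 t, 0 <= t & `|y + t *: d| = M.
Proof.
move=> d0 yM; have nd : 0 < `|d| by rewrite normr_gt0.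
pose g (t : R) : R := `|y + t *: d|.
pose T := (M + `|y|) / `|d|.
have T0 : 0 <= T by rewrite divr_ge0// addr_ge0// (le_trans _ yM).
have g0 : g 0 = `|y| by rewrite /g scale0r addr0.
have gT : M <= g T.
  have -> : M = `|T *: d| - `|y|.
    by rewrite normrZ ger0_norm// divfK ?gt_eqF// addrK.
  by apply: le_trans (lerB_normD _ _) _; rewrite /g addrC.
have cg : ({within `[0, T], continuous g})%classic.
  apply: continuous_subspaceT => t.
  apply: cvg_norm.
  by apply: cvgD; [exact: cvg_cst | apply: cvgZr_tmp; exact: cvg_id].
have [|t] := IVT T0 cg (v := M).
  by rewrite ge_min le_max g0 yM gT orbT.
by rewrite in_itv => /andP[t0 _] gt; exists t.
Qed.

(** The sphere through y + td meets the line again on the other side of y, and the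
    midpoint of the chord so obtained is also a minimum of the norm on the line.
    Strictness makes it equal to y. *)
Lemma strict_min_symmetric (R : realType) (X : normedModType R) (y d : X) :
  isosceles_birkhoff X ->
  (forall t : R, t != 0 -> `|y| < `|y + t *: d|) ->
  forall t, `|y + t *: d| = `|y - t *: d|.
Proof.
move=> H min t; have [->|t0] := eqVneq t 0; first by rewrite scale0r subr0 addr0.
have d0 : d != 0.
  apply/eqP => d0; have := min 1 (oner_neq0 _).
  by rewrite d0 scaler0 addr0 ltxx.
have td0 : - t *: d != 0 by rewrite scaler_eq0 oppr_eq0 negb_or t0.
(* The second point of the sphere is y - st d; the claim amounts to s = 1. *)
have [s s0 es] := norm_line_attains td0 (ltW (min t t0)).
have s1 : 1 + s != 0 by rewrite gt_eqF// ltr_pwDl.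
have := H (y + t *: d) (y + s *: (- t *: d)) (- ((1 - s) / (1 + s))) (esym es).
have -> : y + t *: d + (y + s *: (- t *: d)) = 2 *: (y + ((1 - s) * t / 2) *: d).
  by lincomb y d; field.
have -> : 2 *: (y + ((1 - s) * t / 2) *: d) + - ((1 - s) / (1 + s))
    *: (y + t *: d - (y + s *: (- t *: d))) = 2 *: y.
  by lincomb y d; field.
rewrite !normrZ ler_pM2l ?normr_gt0 ?pnatr_eq0//.
have [|/min + le] := eqVneq ((1 - s) * t / 2) 0; last by rewrite ltNge le.
move=> /eqP; rewrite !mulf_eq0 invr_eq0 pnatr_eq0 (negPf t0) !orbF subr_eq0 => /eqP e1 _.
by rewrite -es -e1 scale1r scaleNr.
Qed.

(** A flat segment [p, q] makes the sphere so angular in the direction d = q - p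
    that the norm has a strict minimum at d on each line directed by an interior
    point of the segment.  The norm is then symmetric about a whole interval of
    points of the line through p and q, hence periodic on it, hence bounded. *)
Lemma isosceles_birkhoff_strict_convex (R : realType) (X : normedModType R)
    (p q : X) :
  isosceles_birkhoff X -> `|p| = `|q| -> 2 * `|p| <= `|p + q| -> p = q.
Proof.
move=> H epq hpq; apply/eqP; rewrite eq_sym -subr_eq0; apply/negPn/negP.
set d := q - p => d0; have nd : 0 < `|d| by rewrite normr_gt0.
have seg_le (l : R) : 0 <= l <= 1 -> `|p + l *: d| <= `|p|.
  move=> /andP[l0 l1].
  have -> : p + l *: d = (1 - l) *: p + l *: q by rewrite /d; lincomb p q; ring.
  apply: le_trans (ler_normD _ _) _; rewrite !normrZ -epq !ger0_norm ?subr_ge0//.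
  by rewrite -mulrDl subrK mul1r.
have seg (l : R) : 0 <= l <= 1 -> `|p + l *: d| = `|p|.
  move=> l01; apply/le_anti; rewrite seg_le//=.
  have h : `|p + (1 - l) *: d| <= `|p| by apply: seg_le; lra.
  have := ler_normD (p + l *: d) (p + (1 - l) *: d).
  have -> : p + l *: d + (p + (1 - l) *: d) = p + q by rewrite /d; lincomb p q; ring.
  lra.
have birk (l t : R) : 0 < l < 1 -> `|d| <= `|d + t *: (p + l *: d)|.
  (* The points of parameters l + c and l - c are both on the segment; the
     hypothesis applies to one of them and to the opposite of the other. *)
  move=> /andP[l0 l1]; pose c := l * (1 - l).
  have c0 : 0 < c by rewrite /c mulr_gt0// subr_gt0.
  have e1 : `|p + (l + c) *: d| = `|p| by apply: seg; rewrite /c; nra.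
  have e2 : `|- (p + (l - c) *: d)| = `|p| by rewrite normrN; apply: seg; rewrite /c; nra.
  have := H _ _ (c * t) (etrans e1 (esym e2)).
  have -> : p + (l + c) *: d - (p + (l - c) *: d) = (2 * c) *: d.
    by lincomb p d; ring.
  have -> : (2 * c) *: d + (c * t) *: (p + (l + c) *: d - - (p + (l - c) *: d))
      = (2 * c) *: (d + t *: (p + l *: d)).
    by lincomb p d; ring.
  by rewrite !(normrZ (2 * c)) ler_pM2l// normr_gt0 gt_eqF// mulr_gt0.
have strict (l : R) : 0 < l < 1 -> forall t : R, t != 0 -> `|d| < `|d + t *: (p + l *: d)|.
  move=> /andP[l0 l1] t t0.
  (* Moving from l to l' on the segment writes the vector as a multiple, by a
     factor greater than 1, of one whose norm is at least that of d. *)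
  have [l' l'01 tl'] : exists2 l', 0 < l' < 1 & 0 < t * (l - l').
    have [tp|tn] := ltrP 0 t.
      by exists (l / 2); [lra | rewrite mulr_gt0//; lra].
    have {}tn : t < 0 by rewrite lt_neqAle t0.
    by exists ((1 + l) / 2); [lra | rewrite nmulr_rgt0//; lra].
  have k0 : 0 < 1 + t * (l - l') by lra.
  have -> : d + t *: (p + l *: d) =
      (1 + t * (l - l')) *: (d + (t / (1 + t * (l - l'))) *: (p + l' *: d)).
    by lincomb p d; field; rewrite gt_eqF.
  rewrite normrZ gtr0_norm// (lt_le_trans (y := (1 + t * (l - l')) * `|d|))//.
    by rewrite ltr_pMl// ltrDl.
  by rewrite ler_pM2l//; apply: birk.
have refl (l r : R) : 0 < l < 1 -> `|p + (l + r) *: d| = `|p + (l - r) *: d|.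
  move=> l01; have [->|r0] := eqVneq r 0; first by rewrite addr0 subr0.
  have := strict_min_symmetric H (strict l l01) r^-1.
  have -> : p + (l + r) *: d = r *: (d + r^-1 *: (p + l *: d)).
    by lincomb p d; field.
  have -> : p + (l - r) *: d = - (r *: (d - r^-1 *: (p + l *: d))).
    by lincomb p d; field.
  by rewrite normrN !normrZ => ->.
have period r : `|p + (r + 1) *: d| = `|p + r *: d|.
  (* The symmetries about 3/4 and 1/4 compose to the translation by 1. *)
  have -> : r + 1 = 3 / 4 + (r + 1 / 4) by field.
  rewrite refl; last lra.
  have -> : 3 / 4 - (r + 1 / 4) = 1 / 4 + (1 / 4 - r) by field.
  rewrite refl; last lra.
  by congr (`|p + _ *: d|); ring.
have const (n : nat) : `|p + n%:R *: d| = `|p|.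
  by elim: n => [|n IH]; [rewrite scale0r addr0 | rewrite -natr1 period].
have /archi_boundP : 0 <= 2 * `|p| / `|d| by rewrite divr_ge0// mulr_ge0.
set n := Num.bound _; rewrite ltr_pdivrMr// => hn.
have := ler_normD (p + n%:R *: d) (- p); rewrite addrC addKr normrN const normrZ.
by rewrite normr_nat; lra.
Qed.

(** By strict convexity, the minimum provided by the hypothesis is strict. *)
Lemma chord_symmetric (R : realType) (X : normedModType R) (u v : X) (t : R) :
  isosceles_birkhoff X -> `|u| = `|v| ->
  `|u + v + t *: (u - v)| = `|u + v - t *: (u - v)|.
Proof.
move=> H uv; have [->|d0] := eqVneq (u - v) 0; first by rewrite scaler0 subr0 addr0.
apply: strict_min_symmetric => // {}t t0.
rewrite lt_neqAle H// andbT; apply/eqP => e.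
suff /eqP : u + v = u + v + t *: (u - v).
  by rewrite -subr_eq0 opprD addNKr oppr_eq0 scaler_eq0 (negPf t0) (negPf d0).
apply: isosceles_birkhoff_strict_convex => //.
have -> : u + v + (u + v + t *: (u - v)) = 2 *: (u + v + (t / 2) *: (u - v)).
  by lincomb u v; field.
by rewrite normrZ ger0_norm// ler_pM2l// H.
Qed.

(** Unless they are opposite vectors, ax + by and bx + ay are, up to a common
    scalar, two points symmetric about x + y on a line directed by x - y. *)
Lemma ficken (R : realType) (X : normedModType R) (x y : X) (a b : R) :
  isosceles_birkhoff X -> `|x| = `|y| -> `|a *: x + b *: y| = `|b *: x + a *: y|.
Proof.
move=> H xy; have [e|ab] := eqVneq (a + b) 0.
  have -> : b = - a by lra.
  by rewrite -normrN opprD !scaleNr opprK addrC.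
have := chord_symmetric ((a - b) / (a + b)) H xy.
have -> : a *: x + b *: y = ((a + b) / 2) *: (x + y + ((a - b) / (a + b)) *: (x - y)).
  by lincomb x y; field.
have -> : b *: x + a *: y = ((a + b) / 2) *: (x + y - ((a - b) / (a + b)) *: (x - y)).
  by lincomb x y; field.
by rewrite !normrZ => ->.
Qed.

(** An even function with strict midpoint convexity increases strictly away from
    its center. *)
Lemma symmetric_line_inj (R : realType) (X : normedModType R) (y d : X) (r s : R) :
  isosceles_birkhoff X -> d != 0 ->
  (forall t : R, `|y + t *: d| = `|y - t *: d|) ->
  `|y + r *: d| = `|y + s *: d| -> `|r| = `|s|.
Proof.
move=> H d0 even.
have abs t : `|y + `|t| *: d| = `|y + t *: d|.
  by case: (ger0P t) => // _; rewrite even scaleNr opprK.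
have incr a b : 0 <= a < b -> `|y + a *: d| < `|y + b *: d|.
  move=> /andP[a0 ab]; have b0 : 0 < b by apply: le_lt_trans ab.
  have y_lt : `|y| < `|y + b *: d|.
    rewrite ltNge; apply/negP => le.
    have : y + b *: d = y - b *: d.
      apply: isosceles_birkhoff_strict_convex => //.
      have -> : y + b *: d + (y - b *: d) = 2 *: y by lincomb y d; ring.
      by rewrite normrZ ger0_norm// ler_pM2l.
    move/addrI/eqP; rewrite -subr_eq0 opprK -scalerDl scaler_eq0 (negPf d0) orbF.
    by rewrite gt_eqF// addr_gt0.
  have [k /andP[k0 k1] ->] : exists2 k : R, 0 <= k < 1 & a = k * b.
    exists (a / b); last by rewrite divfK ?gt_eqF.
    by rewrite divr_ge0 ?(ltW b0)//= ltr_pdivrMr// mul1r.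
  have -> : y + (k * b) *: d = (1 - k) *: y + k *: (y + b *: d).
    by lincomb y d; ring.
  apply: le_lt_trans (ler_normD _ _) _; rewrite !normrZ.
  rewrite gtr0_norm ?subr_gt0// ger0_norm//.
  have : 0 < (1 - k) * (`|y + b *: d| - `|y|) by rewrite mulr_gt0// subr_gt0.
  lra.
rewrite -abs -(abs s) => e; apply/eqP; case: ltgtP => // h.
- by have := incr `|r| `|s|; rewrite normr_ge0 h e ltxx => /(_ isT).
- by have := incr `|s| `|r|; rewrite normr_ge0 h e ltxx => /(_ isT).
Qed.

(** * Pythagoras' theorem and the inner product *)

(** The reflections available are (a, b) to (a, - b), (a, b) to (b, a), and the
    exchange of ne and w = ae + bf, where n is the norm of w.  The last one sends
    the vector bf = w - (a/n) ne of norm abs(b) to (b/n)(ce - af) with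
    c = (n^2 - a^2) / b.  So ce - af has norm n, as be - af does, and
    strict convexity gives c = b. *)
Lemma pythagoras_unit (R : realType) (X : normedModType R) (e f : X) (a b : R) :
  isosceles_birkhoff X -> `|e| = 1 -> `|f| = 1 ->
  (forall t : R, `|e + t *: f| = `|e - t *: f|) ->
  `|a *: e + b *: f| ^+ 2 = a ^+ 2 + b ^+ 2.
Proof.
move=> H ne nf even; have [->|b0] := eqVneq b 0.
  by rewrite scale0r addr0 expr0n addr0 normrZ ne mulr1 real_normK ?num_real.
have conj x y : `|x *: e + y *: f| = `|x *: e - y *: f|.
  have [->|x0] := eqVneq x 0; first by rewrite scale0r add0r sub0r normrN.
  have -> : x *: e + y *: f = x *: (e + (y / x) *: f) by lincomb e f; field.
  have -> : x *: e - y *: f = x *: (e - (y / x) *: f) by lincomb e f; field.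
  by rewrite !normrZ even.
have swap x y : `|x *: e + y *: f| = `|y *: e + x *: f|.
  by apply: ficken; rewrite ?ne ?nf.
have proj x y : `|x| <= `|x *: e + y *: f|.
  have := ler_normD (x *: e + y *: f) (x *: e - y *: f); rewrite -conj.
  have -> : x *: e + y *: f + (x *: e - y *: f) = 2 *: (x *: e) by lincomb e f; ring.
  by rewrite !normrZ ne mulr1 ger0_norm//; lra.
set w := a *: e + b *: f; set n := `|w|.
have n_ge : `|a| <= n by apply: proj.
have n0 : 0 < n by rewrite /n /w swap (lt_le_trans _ (proj b a)) ?normr_gt0.
have fl : `|n *: e| = `|w| by rewrite normrZ ne mulr1 ger0_norm// ltW.
pose c := (n ^+ 2 - a ^+ 2) / b.
have hc : `|- a *: f + c *: e| = `|- a *: f + b *: e|.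
  have -> : `|- a *: f + b *: e| = n by rewrite scaleNr addrC -conj swap.
  have := ficken (- a / n) 1 H fl.
  have -> : (- a / n) *: (n *: e) + 1 *: w = b *: f.
    by rewrite /w; lincomb e f; field; rewrite gt_eqF.
  have -> : 1 *: (n *: e) + (- a / n) *: w = (b / n) *: (- a *: f + c *: e).
    by rewrite /w /c; lincomb e f; field; rewrite ?b0 gt_eqF.
  rewrite !normrZ nf mulr1 normfV (gtr0_norm n0) => h.
  apply: (mulfI (x := `|b| / n)); last by rewrite -h divfK ?gt_eqF.
  by rewrite mulf_neq0 ?normr_eq0// invr_eq0 (gt_eqF n0).
have e0 : e != 0 by rewrite -normr_eq0 ne oner_neq0.
have even' t : `|- a *: f + t *: e| = `|- a *: f - t *: e|.
  by rewrite addrC swap conj -scaleNr [in RHS]addrC -scaleNr [RHS]swap.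
have ecb := symmetric_line_inj H e0 even' hc.
have cb : c * b = n ^+ 2 - a ^+ 2 by rewrite divfK.
(* The norm on the line only determines c up to sign; c and b have the same sign
   because n is at least the absolute value of a. *)
have : 0 <= c * b by rewrite cb subr_ge0 -(real_normK (num_real a)) ler_sqr ?nnegrE// ltW.
have : c ^+ 2 = b ^+ 2 by rewrite -(real_normK (num_real c)) ecb real_normK ?num_real.
move=> /eqP; rewrite eqf_sqr => /orP[] /eqP ec.
  by rewrite ec in cb; lra.
by rewrite ec mulNr oppr_ge0 -expr2 leNgt exprn_even_gt0//= b0.
Qed.

(** Two points of the line y + tx with the same norm have the center of symmetry
    as their midpoint; the intermediate value theorem supplies such points at any
    level above the norm of y. *)
Lemma symmetric_foot (R : realType) (X : normedModType R) (x y : X) :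
  isosceles_birkhoff X -> x != 0 ->
  exists m : R, forall t : R,
    `|y + m *: x + t *: x| = `|y + m *: x - t *: x|.
Proof.
move=> H x0; have yM : `|y| <= `|y| + 1 by rewrite lerDl.
have [r r0 er] := norm_line_attains x0 yM.
have nx0 : - x != 0 by rewrite oppr_eq0.
have [s s0 es] := norm_line_attains nx0 yM.
have r1 : 0 < r.
  rewrite lt_neqAle r0 andbT; apply/eqP => r00.
  by move: er; rewrite -r00 scale0r addr0; lra.
have rs : r + s != 0 by rewrite gt_eqF// ltr_wpDr.
exists ((r - s) / 2) => t.
have := chord_symmetric (2 * t / (r + s)) H (etrans er (esym es)).
have -> : y + r *: x + (y + s *: (- x)) + (2 * t / (r + s)) *:
    (y + r *: x - (y + s *: (- x))) = 2 *: (y + ((r - s) / 2) *: x + t *: x).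
  by lincomb x y; field.
have -> : y + r *: x + (y + s *: (- x)) - (2 * t / (r + s)) *:
    (y + r *: x - (y + s *: (- x))) = 2 *: (y + ((r - s) / 2) *: x - t *: x).
  by lincomb x y; field.
by rewrite !normrZ => /(mulfI _); apply; rewrite normr_eq0 pnatr_eq0.
Qed.

Lemma pythagoras (R : realType) (X : normedModType R) (x z : X) (a b : R) :
  isosceles_birkhoff X -> x != 0 -> z != 0 ->
  (forall t : R, `|z + t *: x| = `|z - t *: x|) ->
  `|a *: x + b *: z| ^+ 2 = a ^+ 2 * `|x| ^+ 2 + b ^+ 2 * `|z| ^+ 2.
Proof.
move=> H x0 z0 even.
have nx0 : `|x| != 0 by rewrite normr_eq0.
have nz0 : `|z| != 0 by rewrite normr_eq0.
have -> : a *: x + b *: z =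
    (b * `|z|) *: (`|z|^-1 *: z) + (a * `|x|) *: (`|x|^-1 *: x).
  by lincomb x z; field; rewrite ?nx0 ?nz0.
rewrite (pythagoras_unit (b * `|z|) (a * `|x|) H); first by ring.
- by rewrite normrZ normfV normr_id mulVf.
- by rewrite normrZ normfV normr_id mulVf.
move=> t.
have -> : `|z|^-1 *: z + t *: (`|x|^-1 *: x)
    = `|z|^-1 *: (z + (`|z| * t / `|x|) *: x).
  by lincomb x z; field; rewrite ?nx0 ?nz0.
have -> : `|z|^-1 *: z - t *: (`|x|^-1 *: x)
    = `|z|^-1 *: (z - (`|z| * t / `|x|) *: x).
  by lincomb x z; field; rewrite ?nx0 ?nz0.
by rewrite !normrZ even.
Qed.

Definition polar (R : realType) (X : normedModType R) (x y : X) : R :=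
  (`|x + y| ^+ 2 - `|x - y| ^+ 2) / 4.

(** Replacing y by the foot z = y + mx of [symmetric_foot] gives a basis of the
    plane in which the squared norm is diagonal. *)
Lemma sqr_norm_quadratic (R : realType) (X : normedModType R) (x y : X) (s t : R) :
  isosceles_birkhoff X ->
  `|s *: x + t *: y| ^+ 2
    = s ^+ 2 * `|x| ^+ 2 + 2 * s * t * polar x y + t ^+ 2 * `|y| ^+ 2.
Proof.
move=> H.
have nZ (k : R) (v : X) : `|k *: v| ^+ 2 = k ^+ 2 * `|v| ^+ 2.
  by rewrite normrZ exprMn real_normK ?num_real.
suff [b quad] : exists b : R, forall s t : R,
    `|s *: x + t *: y| ^+ 2 = s ^+ 2 * `|x| ^+ 2 + 2 * s * t * b + t ^+ 2 * `|y| ^+ 2.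
  rewrite quad; have -> : polar x y = b; last by [].
  have := quad 1 1; have := quad 1 (-1).
  by rewrite /polar scaleN1r !scale1r => -> ->; field.
have [->|x0] := eqVneq x 0.
  exists 0 => {}s {}t; rewrite scaler0 add0r nZ normr0; ring.
have [m even] := symmetric_foot y H x0.
pose z := y + m *: x.
have quad (a b : R) : `|a *: x + b *: z| ^+ 2 = a ^+ 2 * `|x| ^+ 2 + b ^+ 2 * `|z| ^+ 2.
  have [->|z0] := eqVneq z 0; first by rewrite scaler0 addr0 nZ normr0; ring.
  exact: pythagoras.
exists (- m * `|x| ^+ 2) => {}s {}t.
have -> : s *: x + t *: y = (s - t * m) *: x + t *: z by rewrite /z; lincomb x y; ring.
have -> : `|y| ^+ 2 = m ^+ 2 * `|x| ^+ 2 + `|z| ^+ 2.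
  have -> : y = (- m) *: x + 1 *: z by rewrite /z; lincomb x y; ring.
  by rewrite quad; ring.
by rewrite quad; ring.
Qed.

Lemma polarE (R : realType) (X : normedModType R) (x y : X) :
  isosceles_birkhoff X ->
  2 * polar x y = `|x + y| ^+ 2 - `|x| ^+ 2 - `|y| ^+ 2.
Proof.
by move=> /(sqr_norm_quadratic x y 1 1); rewrite !scale1r => ->; ring.
Qed.

Lemma parallelogram (R : realType) (X : normedModType R) (x y : X) :
  isosceles_birkhoff X ->
  `|x + y| ^+ 2 + `|x - y| ^+ 2 = 2 * `|x| ^+ 2 + 2 * `|y| ^+ 2.
Proof.
move=> H; have := sqr_norm_quadratic x y 1 (-1) H.
by have := polarE x y H; rewrite scaleN1r scale1r => h ->; lra.
Qed.

Lemma polarC (R : realType) (X : normedModType R) (x y : X) :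
  polar x y = polar y x.
Proof. by rewrite /polar (addrC x) distrC. Qed.

(** The four parallelogram identities below eliminate the norms of x - y + z,
    x + y - z and y - z: the squared norm of x + y + z becomes a combination of
    those of x + y, x + z, y + z, x, y and z. *)
Lemma polarDl (R : realType) (X : normedModType R) (x y z : X) :
  isosceles_birkhoff X -> polar (x + y) z = polar x z + polar y z.
Proof.
move=> H.
have := polarE (x + y) z H; have := polarE x z H; have := polarE y z H.
have := parallelogram (x + y) z H.
have := parallelogram (x + z) y H.
have := parallelogram x (y - z) H.
have := parallelogram y z H.
rewrite (addrAC x z y) opprB !addrA (addrAC x z).
lra.
Qed.

Lemma polarZl (R : realType) (X : normedModType R) (k : R) (x y : X) :
  isosceles_birkhoff X -> polar (k *: x) y = k * polar x y.
Proof.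
move=> H; have := polarE (k *: x) y H; have := sqr_norm_quadratic x y k 1 H.
have := sqr_norm_quadratic x y k 0 H.
rewrite scale1r scale0r addr0 => -> ->; lra.
Qed.

Lemma polarxx (R : realType) (X : normedModType R) (x : X) :
  polar x x = `|x| ^+ 2.
Proof.
by rewrite /polar subrr normr0 -mulr2n -scaler_nat normrZ normr_nat; field.
Qed.

Lemma isosceles_birkhoff_inner_product (R : realType) (X : normedModType R) :
  isosceles_birkhoff X -> inner_product_space X.
Proof.
move=> H.
have bilin : bilinear_for *%R (idfun \; *%R) (@polar R X).
  have linl (u : X) : linear_for *%R (@polar R X ^~ u).
    by move=> k x y; rewrite polarDl// polarZl.
  split => u; first exact: linl.
  by move=> k x y; rewrite polarC linl !(polarC u).
pose f1 := bilinear_isBilinear.Build _ _ _ _ _ _ _ bilin.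
have herm (x y : X) : polar x y = (-1) ^+ false * idfun (polar y x).
  by rewrite mul1r polarC.
have pos (x : X) : x != 0 -> 0 < polar x x.
  by move=> x0; rewrite polarxx exprn_gt0// normr_gt0.
pose f : {dot X for idfun} := HB.pack (@polar R X) f1
  (isHermitianSesquilinear.Build _ _ _ _ _ herm) (isDotProduct.Build _ _ _ pos).
by exists f => x; rewrite /= polarxx sqrtr_sqr normr_id.
Qed.

(** * The angular inequality *)

(** If x = a^(1/p) u with u a unit vector, then N(x)^p = a and
    N(x)^(p-1) x = au; this parametrizes all nonzero x by u and a > 0. *)
Lemma p_angular_rescale (R : realType) (X : normedModType R) (p : R) : p != 0 ->
  (forall x y : X, x != 0 -> y != 0 ->
     p_angular_distance p x y >=
       (2 * (`|x| `^ p) * (`|y| `^ p) * angular_distance x y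
        + (`|x| `^ p - `|y| `^ p) ^+ 2) / (`|x| `^ p + `|y| `^ p)) <->
  (forall (u v : X) (a b : R), `|u| = 1 -> `|v| = 1 -> 0 < a -> 0 < b ->
     2 * a * b * `|u - v| + (a - b) ^+ 2 <= (a + b) * `|a *: u - b *: v|).
Proof.
move=> p0.
have powB (r : R) : 0 < r -> r `^ (p - 1) = r `^ p * r^-1.
  by move=> r0; rewrite powRB ?(gt_eqF r0) ?implybT// powRr1// ltW.
split=> [h u v a b nu nv a0 b0|h x y x0 y0].
  have key (w : X) (c : R) : `|w| = 1 -> 0 < c ->
      [/\ c `^ p^-1 *: w != 0, `|c `^ p^-1 *: w| = c `^ p^-1,
          `|c `^ p^-1 *: w| `^ p = c & 0 < c `^ p^-1].
    move=> nw c0; have cp := powR_gt0 p^-1 c0.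
    have e : `|c `^ p^-1 *: w| = c `^ p^-1 by rewrite normrZ nw mulr1 gtr0_norm.
    split=> //; first by rewrite -normr_eq0 e gt_eqF.
    by rewrite e -powRrM mulVf// powRr1// ltW.
  have [x0 nx xp ap] := key u a nu a0; have [y0 ny yp bp] := key v b nv b0.
  have := h _ _ x0 y0; rewrite /p_angular_distance /angular_distance !powB ?normr_gt0//.
  rewrite xp yp nx ny !scalerA !divfK ?mulVf ?gt_eqF// !scale1r.
  by rewrite ler_pdivrMr ?addr_gt0// (mulrC `|_|).
have nx : 0 < `|x| by rewrite normr_gt0.
have ny : 0 < `|y| by rewrite normr_gt0.
rewrite /p_angular_distance /angular_distance !powB// -!scalerA.
rewrite ler_pdivrMr ?addr_gt0 ?powR_gt0// (mulrC `|_ *: _ - _|).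
by apply: h; rewrite ?powR_gt0// normrZ normfV normr_id mulVf// gt_eqF.
Qed.

(** For abs(r) < 1, the inequality for u, - v, 1 + r, 1 - r reads
    N(u + v) + r^2 (2 - N(u + v)) <= N(u + v + r(u - v)). *)
Lemma angular_isosceles_birkhoff (R : realType) (X : normedModType R) :
  (forall (u v : X) (a b : R), `|u| = 1 -> `|v| = 1 -> 0 < a -> 0 < b ->
     2 * a * b * `|u - v| + (a - b) ^+ 2 <= (a + b) * `|a *: u - b *: v|) ->
  isosceles_birkhoff X.
Proof.
move=> h u v t uv; have [u0|u0] := eqVneq u 0.
  have -> : v = 0 by apply/eqP; rewrite -normr_eq0 -uv u0 normr0.
  by rewrite u0 addr0 normr0.
have nu : 0 < `|u| by rewrite normr_gt0.
wlog {u0 nu uv} [nu nv] : u v / `|u| = 1 /\ `|v| = 1 => [hw|].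
  have := hw (`|u|^-1 *: u) (`|u|^-1 *: v).
  rewrite !normrZ normfV normr_id -uv mulVf ?gt_eqF// => /(_ (conj erefl erefl)).
  rewrite -scalerDr -scalerBr scalerA mulrC -scalerA -scalerDr !normrZ.
  by rewrite ler_pM2l// normfV normr_id invr_gt0.
(* By convexity it suffices to treat a point between u + v and the given one. *)
pose l := 1 + `|t|; have l0 : 0 < l by rewrite ltr_pwDl.
have tl : `|t / l| < 1.
  by rewrite normf_div (gtr0_norm l0) ltr_pdivrMr// mul1r /l ltrDr.
set r := t / l in tl.
have near : `|u + v| <= `|u + v + r *: (u - v)|.
  have /ltr_normlP [r1 r2] := tl.
  have a0 : 0 < 1 + r by lra.
  have b0 : 0 < 1 - r by lra.
  have := h u (- v) (1 + r) (1 - r) nu; rewrite normrN => /(_ nv a0 b0).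
  rewrite (opprK v).
  have -> : (1 + r) *: u - (1 - r) *: - v = u + v + r *: (u - v).
    by lincomb u v; ring.
  have le2 := ler_normD u v; rewrite nu nv in le2.
  have : 0 <= r ^+ 2 * (2 - `|u + v|) by rewrite mulr_ge0 ?sqr_ge0//; lra.
  lra.
have := ler_normD ((1 - l^-1) *: (u + v)) (l^-1 *: (u + v + t *: (u - v))).
have -> : (1 - l^-1) *: (u + v) + l^-1 *: (u + v + t *: (u - v))
    = u + v + r *: (u - v).
  by rewrite /r; lincomb u v; field; rewrite gt_eqF.
have l1 : l^-1 <= 1 by rewrite invf_le1// /l lerDl.
rewrite !normrZ (ger0_norm (x := 1 - l^-1)) ?subr_ge0//.
rewrite (gtr0_norm (x := l^-1)) ?invr_gt0// => far.
have le : l^-1 * `|u + v| <= l^-1 * `|u + v + t *: (u - v)| by lra.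
by rewrite -(ler_pM2l (x := l^-1)) ?invr_gt0.
Qed.

Lemma inner_product_angular (R : realType) (X : normedModType R)
    (u v : X) (a b : R) :
  inner_product_space X -> `|u| = 1 -> `|v| = 1 -> 0 < a -> 0 < b ->
  2 * a * b * `|u - v| + (a - b) ^+ 2 <= (a + b) * `|a *: u - b *: v|.
Proof.
move=> [f nf] nu nv a0 b0.
have fpos (x : X) : 0 <= f x x.
  have [->|x0] := eqVneq x 0; last exact/ltW/neq0_dnorm_gt0.
  by rewrite linear0.
have sq (x : X) : `|x| ^+ 2 = f x x by rewrite nf sqr_sqrtr.
have fC (x y : X) : f x y = f y x by rewrite hermitian_subproof mul1r.
have expand (c d : R) : `|c *: u - d *: v| ^+ 2 = c ^+ 2 + d ^+ 2 - 2 * c * d * f u v.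
  have fl (x y z : X) (k k' : R) : f (k *: x - k' *: y) z = k * f x z - k' * f y z.
    by rewrite fC linearB !linearZ /= !(fC z).
  rewrite sq fl !(fC _ (c *: u - d *: v)) !fl -!sq nu nv (fC v u); ring.
have e1 : `|u - v| ^+ 2 = 2 - 2 * f u v.
  by have := expand 1 1; rewrite !scale1r => ->; ring.
have le2 := ler_normB u v; rewrite nu nv in le2.
rewrite -ler_sqr ?nnegrE; last 2 first.
- by rewrite addr_ge0 ?sqr_ge0// !mulr_ge0// ltW.
- by rewrite mulr_ge0// addr_ge0// ltW.
have e2 : f u v = 1 - `|u - v| ^+ 2 / 2 by rewrite e1; field.
rewrite -subr_ge0 exprMn expand e2.
rewrite [X in 0 <= X](_ : _ = a * b * (a - b) ^+ 2 * (2 - `|u - v|) ^+ 2); last by field.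
by rewrite mulr_ge0 ?sqr_ge0// mulr_ge0 ?sqr_ge0// mulr_ge0 ?(ltW a0) ?(ltW b0).
Qed.

Unset Implicit Arguments.

Theorem corollary7 (R : realType) (p : R) (hp : p != 0)
    (X : normedModType R) (hdim : dim_at_least X 3) :
  inner_product_space X <->
  (forall x y : X, x != 0 -> y != 0 ->
     p_angular_distance p x y >=
       (2 * (`|x| `^ p) * (`|y| `^ p) * angular_distance x y
        + (`|x| `^ p - `|y| `^ p) ^+ 2)
       / (`|x| `^ p + `|y| `^ p)).
Proof.
split=> [ip|h].
  by apply/(p_angular_rescale X hp) => u v a b; apply: inner_product_angular.
apply/isosceles_birkhoff_inner_product/angular_isosceles_birkhoff.
exact/(p_angular_rescale X hp).
Qed.
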